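(* Let $n\ge 1$ be an integer, let $0\le k<1$, let $\mu\in[k,1]$, and let $\alpha\in[0,1]$. Let $X_1,\dots,X_n$ be independent and identically distributed random variables with the half-Bernoulli distribution $H_{k,\mu}$, that is, each $X_i$ takes values in $\{k,1\}$ with $\Pr(X_i=k)=p_k=\frac{1-\mu}{1-k}$ and $\Pr(X_i=1)=1-p_k$ (so that $\mathbf{E}[X_i]=\mu$). Let $\mathbf{Z}=(Z_1,\dots,Z_n)$, $Z_1\le\cdots\le Z_n$, be the order statistics of $(X_1,\dots,X_n)$. Then $$\Pr\left(m_\alpha(\mathbf{Z})\ge \mu\right)\ge 1-\alpha .$$ In particular (taking $k=0$), this holds for all Bernoulli distributions.
   Context: For vectors $\mathbf{z}=(z_1,\dots,z_n)$ with $0\le z_1\le\cdots\le z_n\le 1$ and $\mathbf{u}=(u_1,\dots,u_n)$ with $0\le u_1\le\cdots\le u_n\le 1$, define $$m(\mathbf{z},\mathbf{u})=1-\sum_{i=1}^n u_i(z_{i+1}-z_i),\qquad z_{n+1}:=1.$$ For a real random variable $Y$ with cumulative distribution function $F_Y$, the quantile function is $Q(1-\alpha,Y)=\inf\{y\in\mathbb{R}:F_Y(y)\ge 1-\alpha\}$ (as an extended real number; the infimum of $\mathbb{R}$ is $-\infty$). Let $\mathbf{U}=(U_1,\dots,U_n)$ be the order statistics (sorted increasingly) of $n$ independent samples from the continuous uniform distribution on $[0,1]$. For fixed $\mathbf{z}$ define $$m_\alpha(\mathbf{z})=Q(1-\alpha,\,m(\mathbf{z},\mathbf{U})),$$ the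 $(1-\alpha)$-quantile of the random variable $m(\mathbf{z},\mathbf{U})$, where only $\mathbf{U}$ is random. *)

(* Defs.v *)
From HB Require Import structures.
From mathcomp Require Import all_boot all_order all_algebra.
From mathcomp Require Import all_classical all_reals all_analysis.
From mathcomp Require Import measurable_realfun.

Set Implicit Arguments.
Unset Strict Implicit.
Unset Printing Implicit Defensive.

Import Order.TTheory GRing.Theory Num.Theory.
Import numFieldNormedType.Exports.

Local Open Scope classical_set_scope.
Local Open Scope ring_scope.

(* m(z, u) = 1 - sum_i u_i (z_(i+1) - z_i). Indices start at 0, and the default
   value 1 of [nth] supplies the convention z_(n+1) := 1. *)
Definition induced_mean (R : realType) (n : nat) (z u : n.-tuple R) : R :=
  1 - \sum_(i < n) nth 1 u i * (nth 1 z i.+1 - nth 1 z i).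

Definition order_stats (R : realType) (n : nat) (x : n.-tuple R) : n.-tuple R :=
  [tuple of sort <=%R x].

Section RandomVariables.
Context d (T : measurableType d) (R : realType) (P : probability T R).

(* The laws are compared on Borel sets only: a [probability] is a total
   function on [set T], with no meaning on nonmeasurable sets. *)
Definition has_law (X : {RV P >-> R}) (nu : set R -> \bar R) : Prop :=
  forall A : set R, measurable A -> distribution P X A = nu A.

Definition mutually_independent (n : nat) (X : 'I_n -> {RV P >-> R}) : Prop :=
  forall (J : {set 'I_n}) (A : 'I_n -> set R), (forall i, measurable (A i)) ->
    P (\bigcap_(i in [set` J]) X i @^-1` A i) =
    (\prod_(i in J) P (X i @^-1` A i))%E.

Definition iid (n : nat) (X : 'I_n -> {RV P >-> R}) (nu : set R -> \bar R) :
    Prop :=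
  mutually_independent X /\ forall i, has_law (X i) nu.

Definition order_stats_RV (n : nat) (X : 'I_n -> {RV P >-> R}) (w : T) :
    n.-tuple R :=
  order_stats [tuple X i w | i < n].

Definition quantile (p : R) (Y : {RV P >-> R}) : \bar R :=
  ereal_inf [set y%:E | y in [set y : R | (p%:E <= cdf Y y)%E]].

End RandomVariables.

Definition half_bernoulli (R : realType) (k mu : R) (A : set R) : \bar R :=
  let p := (1 - mu) / (1 - k) in
  (p%:E * \d_k A + (1 - p)%R%:E * \d_(1%R : R) A)%E.

(* The library's Bernoulli law lives on [bool]; this is its image on {0, 1}. *)
Definition bernoulli_law (R : realType) (mu : R) : set R -> \bar R :=
  pushforward (bernoulli_prob mu) (fun b : bool => (b%:R : R)).

Definition uniform01 (R : realType) : set R -> \bar R :=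
  uniform_prob (@ltr01 R).

Lemma sorted_nth_le_count (R : realType) (s : seq R) (t : R) (i : nat) :
  sorted <=%R s -> (i < size s)%N ->
  (nth 1 s i <= t) = (i < count (fun x : R => (x <= t)%R) s)%N.
Proof.
elim: s i => //= x s IHs i pxs.
have srt : sorted <=%R s by exact: path_sorted pxs.
have allx : all (fun y => x <= y) s by exact: order_path_min le_trans pxs.
have [xt|tx] := leP x t.
  by case: i => [|i] //=; rewrite ltnS => /(IHs _ srt) ->; rewrite add1n ltnS.
have c0 : count (fun y : R => (y <= t)%R) s = 0%N.
  apply/eqP; rewrite -leqn0 leqNgt -has_count; apply/hasPn => y ys.
  by rewrite -ltNge (lt_le_trans tx)// (allP allx).
rewrite c0 add0n ltn0 => iS; apply/negbTE; rewrite -ltNge.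
case: i iS => //= i; rewrite ltnS => iS.
by rewrite (lt_le_trans tx)// (allP allx)// mem_nth.
Qed.

Section InducedMean.
Context d (T : measurableType d) (R : realType) (P : probability T R).
Variables (n : nat) (V : 'I_n -> {RV P >-> R}).

Lemma measurable_order_stats_RV (i : nat) :
  measurable_fun setT (fun w => nth 1 (order_stats_RV V w) i).
Proof.
have [ni|ni] := leqP n i.
  rewrite (_ : (fun w => _) = cst 1); first exact: measurable_cst.
  by apply/funext => w; rewrite nth_default// size_tuple.
pose c (t : R) (s : seq 'I_n) (w : T) := (\sum_(j <- s) ((V j w <= t)%R : nat))%N.
have mc t s : measurable_fun setT (c t s).
  elim: s => [|j s IHs].
    rewrite (_ : c t [::] = cst 0%N); first exact: measurable_cst.
    by apply/funext => w; rewrite /c big_nil.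
  rewrite (_ : c t (j :: s) = fun w => ((V j w <= t)%R : nat) + c t s w)%N.
    apply: measurable_fun_addn => //.
    apply: (@measurableT_comp _ _ _ _ _ _ (fun b : bool => b : nat)) => //.
    exact: measurable_fun_ler.
  by apply/funext => w; rewrite /c big_cons.
move=> mT; apply: (measurability _ (RGenOInfty.measurableE R)) => //.
move=> _ [_ [t ->] <-].
have gtE w : (t < nth 1 (order_stats_RV V w) i) =
    (c t (index_enum 'I_n) w <= i)%N.
  rewrite ltNge sorted_nth_le_count ?size_tuple ?sort_le_sorted// -leqNgt.
  by rewrite count_sort -sum1_count big_map big_mkcond/= enumT.
rewrite (_ : _ @^-1` _ = c t (index_enum 'I_n) @^-1` [set m | (m <= i)%N]).
  exact: mc.
by apply/seteqP; split=> w /=; rewrite in_itv/= andbT gtE.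
Qed.

Definition induced_mean_RV (z : n.-tuple R) (w : T) : R :=
  induced_mean z (order_stats_RV V w).

Lemma measurable_induced_mean_RV (z : n.-tuple R) :
  measurable_fun setT (induced_mean_RV z).
Proof.
apply: measurable_funB => //; apply: measurable_sum => i.
by apply: measurable_funM => //; exact: measurable_order_stats_RV.
Qed.

HB.instance Definition _ (z : n.-tuple R) :=
  isMeasurableFun.Build _ _ T R (induced_mean_RV z)
    (measurable_induced_mean_RV z).

(* m_alpha(z); V is the unsorted sample. *)
Definition m_alpha (alpha : R) (z : n.-tuple R) : \bar R :=
  quantile (1 - alpha) (induced_mean_RV z : {RV P >-> R}).

End InducedMean.

(* Main.v *)
(* If j of the X_i equal k and the others equal 1, then
   m(Z, U) = 1 - (1 - k) U_j (and 1 if j = 0), while mu = 1 - (1 - k) p for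
   p = p_k. Hence m_alpha(Z) < mu forces g(j) >= 1 - alpha, where
   g(j) = Pr(U_j > p) is the probability that fewer than j uniform samples are
   <= p. The number of uniform samples <= p and the number K of observations
   equal to k are both Binomial(n, p), so g(j) = Pr(K < j). With j0 the least j
   such that g(j) >= 1 - alpha, the bound mu <= m_alpha(Z) holds whenever K < j0,
   an event of probability g(j0) >= 1 - alpha. *)

Require Import Defs.
From mathcomp Require Import all_boot all_order all_algebra.
From mathcomp Require Import all_classical all_reals all_analysis.
From mathcomp Require Import measurable_realfun.

Set Implicit Arguments.
Unset Strict Implicit.
Unset Printing Implicit Defensive.

Import Order.TTheory GRing.Theory Num.Theory.

Local Open Scope classical_set_scope.
Local Open Scope ring_scope.

(** * Law of the random set of indices whose value is at most a threshold *)

Section Hits.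
Context d (T : measurableType d) (R : realType) (P : probability T R).
Variables (n : nat) (X : 'I_n -> {RV P >-> R}) (t : R).

(** Keeping the set, not only its size, makes each fiber an intersection of independent events, so
    no binomial coefficients arise. *)
Definition hits (w : T) : {set 'I_n} := [set i | (X i w <= t)%R]%SET.

Lemma count_order_stats_RV (w : T) :
  count (fun x => x <= t) (order_stats_RV X w) = #|hits w|.
Proof.
rewrite count_sort count_map -sum1_count -sum1_card big_enum_cond.
by apply: eq_bigl => i; rewrite !inE.
Qed.

Lemma hits_fiber (J : {set 'I_n}) :
  hits @^-1` [set J] =
  (* Indexing by the full finite set matches the form of [mutually_independent]. *)
  \bigcap_(i in [set` [set: 'I_n]%SET])
    X i @^-1` (if i \in J then [set` `]-oo, t]] else ~` `]-oo, t]).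
Proof.
apply/seteqP; split=> [w /= <- i _ /=|w XJ /=].
  by rewrite inE; case: ifPn => h /=; rewrite in_itv//=; exact/negP.
apply/setP => i; rewrite inE; have := XJ i; rewrite /= inE => /(_ isT).
by case: ifPn => _ /=; rewrite in_itv//= => /negP/negbTE.
Qed.

Lemma measurable_hits_preimage (S : set {set 'I_n}) :
  measurable (hits @^-1` S).
Proof.
rewrite -[S]image_id -bigcup_imset1 preimage_bigcup.
apply: fin_bigcup_measurable => [|J _]; first exact: finite_finset.
rewrite hits_fiber; apply: fin_bigcap_measurable => [|i _].
  exact: finite_finset.
apply: measurable_funPTI.
by case: ifPn => _ //; exact: measurableC.
Qed.

Hypothesis indepX : mutually_independent X.
Variable p : R.
Hypothesis cdfX : forall i, cdf (X i) t = p%:E.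

Lemma probability_hits_fiber (J : {set 'I_n}) :
  P (hits @^-1` [set J]) = (\prod_(i < n) (if i \in J then p else 1 - p))%:E.
Proof.
rewrite hits_fiber indepX; last first.
  by move=> i; case: ifPn => _ //; exact: measurableC.
rewrite -prodEFin; apply: eq_big => [i|i _]; first by rewrite inE.
case: ifPn => _; first exact: cdfX.
have mX : measurable (X i @^-1` `]-oo, t]) by exact: measurable_funPTI.
by rewrite preimage_setC (probability_setC P mX) EFinB -(cdfX i).
Qed.

(** The right-hand side depends on the sample only through [n] and [p]; this allows two different
    samples to be compared. *)
Lemma probability_hits (S : set {set 'I_n}) :
  P (hits @^-1` S) =
  (\sum_(J \in S) (\prod_(i < n) (if i \in J then p else 1 - p))%:E)%E.
Proof.
rewrite -[in LHS](image_id S) -bigcup_imset1 preimage_bigcup.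
rewrite measure_fin_bigcup.
- by apply: eq_fsbigr => J _; exact: probability_hits_fiber.
- exact: finite_finset.
- by move=> J K _ _ [w [/= <- <-]].
- by move=> J _; exact: measurable_hits_preimage.
Qed.

End Hits.

Lemma two_point_nth (R : realType) (n : nat) (z : n.-tuple R) (k : R) (i : nat) :
  k < 1 -> sorted <=%R z -> all [pred x | (x == k) || (x == 1)] z ->
  nth 1 z i = if (i < count (fun x => (x <= k)%R) z)%N then k else 1.
Proof.
move=> k1 sz /allP zk; have [ni|ni] := leqP n i.
  (* Past the end, the default value 1 agrees with the claim, since the count is at most [n]. *)
  rewrite nth_default ?size_tuple// ifN// -leqNgt (leq_trans _ ni)//.
  by rewrite -[leqRHS](size_tuple z) count_size.
rewrite -sorted_nth_le_count ?size_tuple//.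
have /zk /= : nth 1 z i \in z by rewrite mem_nth ?size_tuple.
by case/orP => /eqP ->; rewrite ?lexx// leNgt k1.
Qed.

(* On a sample with values in {k, 1}, only the jump of z from k to 1
   contributes to m(z, u). *)
Lemma induced_mean_two_point (R : realType) (n : nat) (z u : n.-tuple R)
    (k p : R) :
  k < 1 -> 0 <= p -> sorted <=%R z -> sorted <=%R u ->
  all [pred x | (x == k) || (x == 1)] z ->
  induced_mean z u < 1 - (1 - k) * p ->
  (count (fun x => (x <= p)%R) u < count (fun x => (x <= k)%R) z)%N.
Proof.
move=> k1 p0 sz su zk; set N := count _ z.
have Nn : (N <= n)%N by rewrite -[leqRHS](size_tuple z) count_size.
have k10 : 0 < 1 - k by rewrite subr_gt0.
rewrite /induced_mean ltrD2l ltrN2.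
under eq_bigr => i _.
  rewrite !(two_point_nth _ k1 sz zk) -/N
    (* Counting from 0, the values [k] fill the positions below [N], so the jump is from [N - 1] to
       [N]; if [N = n], it ends at the default 1. *)
    (_ : _ - _ = if i.+1 == N then 1 - k else 0); last first.
    by rewrite [(i < N)%N]leq_eqVlt; case: ltngtP => _; rewrite ?subrr.
  over.
case: N Nn => [_|j jn].
  rewrite big1; last by move=> i _; rewrite mulr0.
  by rewrite ltNge mulr_ge0// ltW.
rewrite (bigD1 (Ordinal jn))//= eqxx big1 => [|i ij]; last first.
  by rewrite eqSS ifN ?mulr0//; apply: contra ij => /eqP ij; exact/eqP/val_inj.
(* Cancelling [1 - k] leaves [p < nth 1 u j]: at most [j] entries of [u] are [<= p]. *)
rewrite addr0 mulrC ltr_pM2r// ltNge sorted_nth_le_count ?size_tuple//.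
by rewrite -leqNgt.
Qed.

(* The observations may leave {k, 1} on a null set, where m_alpha(Z) is the
   quantile at an arbitrary z; measurability of the event therefore has to be
   shown for general Z, by Fubini. *)
Section MeasurableQuantile.
Context d' (T' : measurableType d') (R : realType) (P' : probability T' R).
Context d (T : measurableType d) (P : probability T R).
Variables (n : nat) (V : 'I_n -> {RV P' >-> R}) (X : 'I_n -> {RV P >-> R}).

Definition induced_cdf (y : R) (w : T) : \bar R :=
  cdf (induced_mean_RV V (order_stats_RV X w) : {RV P' >-> R}) y.

Lemma measurable_induced_cdf (y : R) : measurable_fun setT (induced_cdf y).
Proof.
pose f (x : T * T') := induced_mean (order_stats_RV X x.1) (order_stats_RV V x.2).
have mf : measurable_fun setT f.
  apply: measurable_funB => //; apply: measurable_sum => i.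
  apply: measurable_funM; last apply: measurable_funB.
  - exact: (measurableT_comp (measurable_order_stats_RV V i) measurable_snd).
  - exact: (measurableT_comp (measurable_order_stats_RV X i.+1) measurable_fst).
  - exact: (measurableT_comp (measurable_order_stats_RV X i) measurable_fst).
(* The cdf at [y] is the measure of a section of a measurable set in the product space. *)
rewrite (_ : induced_cdf y = P' \o xsection (f @^-1` `]-oo, y])).
  apply: measurable_fun_xsection.
  by rewrite -[X in measurable X]setTI; exact: mf.
by apply/funext => w /=; rewrite xsectionE.
Qed.

(** Since a cdf is monotone, it suffices to test it along a sequence increasing to [mu]; this makes
    the event a countable intersection. *)
Lemma m_alpha_geE (alpha mu : R) (w : T) :
  (mu%:E <= m_alpha V alpha (order_stats_RV X w))%E <->
  forall m : nat, (induced_cdf (mu - m.+1%:R^-1) w < (1 - alpha)%:E)%E.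
Proof.
rewrite /m_alpha /quantile; split=> [/ereal_infP mu_le m|cdf_lt].
  rewrite ltNge; apply/negP => cdf_ge.
  have := mu_le (mu - m.+1%:R^-1)%:E; rewrite lee_fin => /(_ _)/wrap[].
    by exists (mu - m.+1%:R^-1).
  by rewrite leNgt ltrBlDr ltrDl invr_gt0 ltr0n.
apply/ereal_infP => _ [y /= cdf_ge <-]; rewrite lee_fin leNgt; apply/negP => ymu.
have [m ym] : exists m : nat, y <= mu - m.+1%:R^-1.
  exists (Num.truncn (mu - y)^-1); rewrite lerBrDr -lerBrDl.
  rewrite -[leRHS]invrK lef_pV2 ?posrE ?invr_gt0 ?subr_gt0//.
  exact/ltW/truncnS_gt.
have := cdf_lt m; rewrite ltNge => /negP; apply.
exact: (le_trans cdf_ge (cdf_nondecreasing _ ym)).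
Qed.

Lemma measurable_m_alpha_ge (alpha mu : R) :
  measurable [set w | (mu%:E <= m_alpha V alpha (order_stats_RV X w))%E].
Proof.
rewrite (_ : [set w | _] = \bigcap_m
    [set w | (induced_cdf (mu - m.+1%:R^-1) w < (1 - alpha)%:E)%E]).
  apply: bigcap_measurable => // m _; rewrite -[X in measurable X]setTI.
  by apply: emeasurable_fun_infty_o => //; exact: measurable_induced_cdf.
by apply/seteqP; split=> w /= => [/m_alpha_geE + m _|H];
  [exact|apply/m_alpha_geE => m; exact: H].
Qed.

End MeasurableQuantile.

Lemma uniform01_le (R : realType) (t : R) : 0 <= t <= 1 ->
  @uniform01 R `]-oo, t] = t%:E.
Proof.
move=> /andP[t0 t1]; rewrite /uniform01 /uniform_prob integral_uniform_pdf.
rewrite (_ : _ `&` _ = [set` `[0, t]]).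
  rewrite (eq_integral (fun=> 1%:E)); last first.
    move=> x; rewrite inE/= in_itv/= /uniform_pdf subr0 invr1 => /andP[-> xt].
    by rewrite (le_trans xt).
  rewrite integral_cst//= lebesgue_measure_itv/= lte_fin mul1e.
  by case: ltP => [_|t0']; rewrite ?sube0//; congr EFin; apply/le_anti/andP.
apply/seteqP; split=> x /=; rewrite !in_itv/=.
  by move=> [xt /andP[-> _]].
by move=> /andP[-> xt]; rewrite xt (le_trans xt).
Qed.

Lemma bernoulli_law_half (R : realType) (mu : R) (A : set R) : 0 <= mu <= 1 ->
  bernoulli_law mu A = half_bernoulli 0 mu A.
Proof.
move=> mu01; rewrite /bernoulli_law /pushforward bernoulli_probE//.
rewrite /half_bernoulli subr0 divr1 subKr addeC.
by congr (_ * _ + _ * _)%E; rewrite !diracE.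
Qed.

(** * Coverage for half-Bernoulli samples *)

Section HalfBernoulli.
Context (R : realType) (n : nat).
Context d' (T' : measurableType d') (P' : probability T' R).
Context d (T : measurableType d) (P : probability T R).
Variables (V : 'I_n -> {RV P' >-> R}) (X : 'I_n -> {RV P >-> R}).
Variables (alpha k mu : R).
Hypotheses (k01 : 0 <= k < 1) (kmu1 : k <= mu <= 1).
Hypotheses (hV : iid V (@uniform01 R)) (hX : iid X (half_bernoulli k mu)).

Let p := (1 - mu) / (1 - k).

Let k1 : k < 1. Proof. by case/andP: k01. Qed.

Let p01 : 0 <= p <= 1.
Proof.
case/andP: kmu1 => kmu mu1; rewrite /p divr_ge0 ?subr_ge0 ?(ltW k1)//=.
by rewrite ler_pdivrMr ?subr_gt0// mul1r lerD2l lerN2.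
Qed.

Let muE : mu = 1 - (1 - k) * p.
Proof. by rewrite /p mulrC divfK ?subKr// subr_eq0 gt_eqF. Qed.

Let cdfV i : cdf (V i) p = p%:E.
Proof. by rewrite /cdf hV.2// uniform01_le. Qed.

Let cdfX i : cdf (X i) k = p%:E.
Proof.
rewrite /cdf hX.2// /half_bernoulli -/p !diracE !mem_setE !in_itv/= lexx leNgt k1.
by rewrite mule1 mule0 adde0.
Qed.

Let two_point := [set w | forall i, X i w = k \/ X i w = 1].

Let measurable_two_point : measurable two_point.
Proof.
rewrite (_ : two_point = \bigcap_(i in [set: 'I_n]) X i @^-1` [set k; 1]).
  apply: fin_bigcap_measurable => [|i _]; first exact: finite_finset.
  apply: measurable_funPTI.
  exact: measurableU.
by apply/seteqP; split=> w /= H i => [_|]; exact: H.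
Qed.

Let probability_two_pointC : P (~` two_point) = 0%E.
Proof.
rewrite probability_setC// (_ : two_point =
    \bigcap_(i in [set` [set: 'I_n]%SET]) X i @^-1` [set k; 1]).
  rewrite hX.1; last by move=> i; exact: measurableU.
  rewrite big1 ?subee// => i _.
  have := hX.2 i [set k; 1]; rewrite /distribution /pushforward => ->.
    rewrite /half_bernoulli -/p !diracE !mem_set/= ?mule1; [|by right|by left].
    by rewrite -EFinD addrC subrK.
  exact: measurableU.
apply/seteqP; split=> w /= H i; first by move=> _; exact: H.
by apply: H; rewrite /= inE.
Qed.

Let g (j : nat) : \bar R := P' [set v | (#|hits V p v| < j)%N].

(** A uniform value is [<= p] with the same probability [p] as an observation is [<= k], so both hit
    sets have the same law. *)
Let gE j : g j = P [set w | (#|hits X k w| < j)%N].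
Proof.
have [[iV _] [iX _]] := (hV, hX).
rewrite /g -[X in P' X]/(hits V p @^-1` [set J | (#|J| < j)%N]).
by rewrite (probability_hits iV cdfV) -(probability_hits iX cdfX).
Qed.

(** For each [y < mu], an induced mean [<= y] forces fewer uniform hits than observed ones, so the
    cdf at [y] is at most [g] of the observed count. *)
Let m_alpha_ge w : two_point w -> (g #|hits X k w| < (1 - alpha)%:E)%E ->
  (mu%:E <= m_alpha V alpha (order_stats_RV X w))%E.
Proof.
move=> Xw gw; apply/m_alpha_geE => m; apply: le_lt_trans gw.
rewrite /induced_cdf /cdf /distribution /pushforward.
apply: le_measure; rewrite ?inE.
- exact: measurable_funPTI.
- exact: (measurable_hits_preimage V p [set J | (#|J| < #|hits X k w|)%N]).
move=> v /=; rewrite in_itv/= => le_y.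
rewrite -!count_order_stats_RV; apply: induced_mean_two_point => //.
- by case/andP: p01.
- exact: sort_le_sorted.
- exact: sort_le_sorted.
- rewrite all_sort all_map; apply/allP => i _ /=.
  by case: (Xw i) => ->; rewrite eqxx ?orbT.
- rewrite -muE; apply: le_lt_trans le_y _.
  by rewrite ltrBlDr ltrDl invr_gt0 ltr0n.
Qed.

Lemma half_bernoulli_m_alpha : 0 <= alpha ->
  ((1 - alpha)%:E <=
    P [set w | (mu%:E <= m_alpha V alpha (order_stats_RV X w))%E])%E.
Proof.
move=> alpha0; set S := [set w | _].
have mS : measurable S := measurable_m_alpha_ge V X alpha mu.
(* Outcomes outside [two_point] form a null set, so inclusions in [S] are only needed up to them. *)
have PS (B : set T) : measurable B -> B `<=` S `|` ~` two_point ->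
    (P B <= P S)%E.
  move=> mB BS; rewrite -[leRHS]adde0 -probability_two_pointC.
  apply: (le_trans (le_measure _ _ _ BS)); rewrite ?inE//.
    by apply: measurableU => //; exact: measurableC.
  by apply: measureU2 => //; exact: measurableC.
pose large j := ((1 - alpha)%:E <= g j)%E.
(* If no [j] is large, every two-point outcome lies in [S], so [S] has probability 1; this saves
   evaluating [g] at [n.+1]. *)
have [[j lj]|nolarge] := pselect (exists j, large j); last first.
  apply: (@le_trans _ _ (P setT)).
    by rewrite probability_setT lee_fin gerBl.
  apply: PS => // w _; have [Xw|] := pselect (two_point w); last by right.
  left; apply: m_alpha_ge => //; rewrite ltNge; apply/negP => lw.
  by apply: nolarge; eexists; exact: lw.
case: (ex_minnP (ex_intro large j lj)) => j0 lj0 j0_min.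
apply: (le_trans lj0); rewrite gE; apply: PS.
  exact: (measurable_hits_preimage X k [set J | (#|J| < j0)%N]).
move=> w /= wj0; have [Xw|] := pselect (two_point w); last by right.
(* A count below [j0] is not large, by minimality of [j0]. *)
left; apply: m_alpha_ge => //; rewrite ltNge; apply/negP => /j0_min.
by rewrite leqNgt wj0.
Qed.

End HalfBernoulli.

Theorem mainTheorem1 (R : realType) (n : nat) (hn : (1 <= n)%N)
    (alpha : R) (halpha : 0 <= alpha <= 1)
    (d' : measure_display) (T' : measurableType d') (P' : probability T' R)
    (V : 'I_n -> {RV P' >-> R}) (hV : iid V (@uniform01 R))
    (d : measure_display) (T : measurableType d) (P : probability T R)
    (X : 'I_n -> {RV P >-> R}) :
  (forall k mu : R, 0 <= k < 1 -> k <= mu <= 1 ->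
     iid X (half_bernoulli k mu) ->
     ((1 - alpha)%:E <=
       P [set w | (mu%:E <= m_alpha V alpha (order_stats_RV X w))%E])%E)
  /\
  (forall mu : R, 0 <= mu <= 1 ->
     iid X (bernoulli_law mu) ->
     ((1 - alpha)%:E <=
       P [set w | (mu%:E <= m_alpha V alpha (order_stats_RV X w))%E])%E).
Proof.
have /andP[alpha0 _] := halpha.
split=> [k mu k01 kmu1 hX|mu mu01 [iX lX]].
  exact: half_bernoulli_m_alpha k01 kmu1 hV hX alpha0.
apply: (@half_bernoulli_m_alpha _ _ _ _ _ _ _ _ V X alpha 0 mu) => //.
  by rewrite lexx ltr01.
by split=> // i A mA; rewrite lX// bernoulli_law_half.
Qed.
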